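(* Let $\mathcal{D}\subset\mathbb{R}^n$ be a compact convex set, let $f:\mathbb{R}^n\to\mathbb{R}$ be convex and differentiable, and let $x^*$ be a minimizer of $f$ over $\mathcal{D}$ that lies in the relative interior of $\mathcal{D}$. Let $C_f$ be the curvature constant of $f$ over $\mathcal{D}$, assumed to satisfy $0<C_f<\infty$, and let $\mu_f^{FW}$ be the interior strong convexity constant of $f$ over $\mathcal{D}$ with respect to $x^*$ (both defined in the context). Let $(x^{(k)})_{k\ge 0}$ be the iterates of the Frank-Wolfe algorithm (see context) with step-sizes $\gamma_k:=\min\{1,\, g_k/C_f\}$, or with step-sizes chosen by line-search. Write $h_k := f(x^{(k)})-f(x^* )$ for the primal error and $g_k:=\max_{s\in\mathcal{D}}\langle\nabla f(x^{(k)}),x^{(k)}-s\rangle$ for the duality gap. Then for every $k\ge 0$, $$h_{k+1}\le\left(1-\rho_f^{FW}\right)h_k,\qquad\text{where } \rho_f^{FW}:=\min\left\{\tfrac12,\ \frac{\mu_f^{FW}}{C_f}\right\}.$$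
   Context: Curvature constant: $$C_f:=\sup\left\{\tfrac{2}{\gamma^2}\big(f(y)-f(x)-\langle\nabla f(x),y-x\rangle\big)\ :\ x,s\in\mathcal{D},\ \gamma\in(0,1],\ y=x+\gamma(s-x)\right\}.$$ Interior strong convexity constant (for $x^*$ in the relative interior of $\mathcal{D}$): $$\mu_f^{FW}:=\inf\left\{\tfrac{2}{\gamma^2}\big(f(y)-f(x)-\langle\nabla f(x),y-x\rangle\big)\ :\ x\in\mathcal{D}\setminus\{x^*\},\ \gamma\in(0,1],\ \bar s=\bar s(x,x^*,\mathcal{D}),\ y=x+\gamma(\bar s-x)\right\},$$ where $\bar s(x,x^*,\mathcal{D})$ is the point where the ray starting at $x$ and passing through $x^*$ meets the (relative) boundary of $\mathcal{D}$, i.e. the point of that ray that is furthest from $x$ while still in $\mathcal{D}$. Frank-Wolfe algorithm: let $\mathcal{V}$ be the set of extreme points of $\mathcal{D}$, so $\mathcal{D}=\operatorname{conv}(\mathcal{V})$. Start from $x^{(0)}\in\mathcal{V}$. At iteration $k$, choose $s_k\in\arg\min_{v\in\mathcal{V}}\langle\nabla f(x^{(k)}),v\rangle$ and set $x^{(k+1)}:=x^{(k)}+\gamma_k(s_k-x^{(k)})$ with $\gamma_k\in[0,1]$. Line-search means $\gamma_k\in\arg\min_{\gamma\in[0,1]}f\big(x^{(k)}+\gamma(s_k-x^{(k)})\big)$. *)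

(* Defs.v *)
From HB Require Import structures.
From mathcomp Require Import all_boot all_order all_algebra.
From mathcomp Require Import all_classical all_reals all_analysis.

Set Implicit Arguments.
Unset Strict Implicit.
Unset Printing Implicit Defensive.

Import Order.TTheory GRing.Theory Num.Theory.
Import numFieldNormedType.Exports.

Local Open Scope classical_set_scope.
Local Open Scope ring_scope.

Definition dot (R : realType) (n : nat) (u v : 'rV[R]_n) : R :=
  \sum_(i < n) u 0 i * v 0 i.

(* The library's norm on ['rV[R]_n] is the sup norm; the two norms define the
   same topology and the same notion of differentiability. *)
Definition enorm (R : realType) (n : nat) (u : 'rV[R]_n) : R :=
  Num.sqrt (dot u u).

Definition grad (R : realType) (n : nat) (f : 'rV[R]_n -> R) (x : 'rV[R]_n) :
    'rV[R]_n :=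
  \row_(i < n) 'D_(delta_mx 0 i) f x.

Definition argmin (T : Type) (R : realType) (A : set T) (F : T -> R) : set T :=
  [set a | A a /\ forall b, A b -> F a <= F b].

Definition argmax (T : Type) (R : realType) (A : set T) (F : T -> R) : set T :=
  [set a | A a /\ forall b, A b -> F b <= F a].

Definition affine_hull (R : realType) (n : nat) (D : set 'rV[R]_n) :
    set 'rV[R]_n :=
  [set y | exists (m : nat) (p : 'I_m -> 'rV[R]_n) (c : 'I_m -> R),
    [/\ forall i, D (p i), \sum_(i < m) c i = 1 &
        y = \sum_(i < m) c i *: p i]].

Definition relative_interior (R : realType) (n : nat) (D : set 'rV[R]_n) :
    set 'rV[R]_n :=
  [set x | D x /\ \forall y \near x, affine_hull D y -> D y].

Definition extreme_points (R : realType) (n : nat) (D : set 'rV[R]_n) :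
    set 'rV[R]_n :=
  [set v | D v /\ forall (a b : 'rV[R]_n) (t : R), D a -> D b -> 0 < t < 1 ->
    v = t *: a + (1 - t) *: b -> a = v /\ b = v].

Definition ray (R : realType) (n : nat) (x z : 'rV[R]_n) : set 'rV[R]_n :=
  [set x + t *: (z - x) | t in [set t : R | 0 <= t]].

(* For compact convex [D], [xs] in [D] and [x] in [D] with [x != xs], this set
   is the singleton of the point usually written sbar(x, xs, D). *)
Definition ray_exit (R : realType) (n : nat) (D : set 'rV[R]_n)
    (x xs : 'rV[R]_n) : set 'rV[R]_n :=
  argmax (ray x xs `&` D) (fun s => enorm (s - x)).

Definition scaled_gap (R : realType) (n : nat) (f : 'rV[R]_n -> R)
    (gamma : R) (x y : 'rV[R]_n) : R :=
  2 / gamma ^+ 2 * (f y - f x - dot (grad f x) (y - x)).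

Definition curvature (R : realType) (n : nat) (f : 'rV[R]_n -> R)
    (D : set 'rV[R]_n) : \bar R :=
  ereal_sup [set r | exists (x s : 'rV[R]_n) (gamma : R),
    [/\ D x, D s, 0 < gamma <= 1 &
        r = (scaled_gap f gamma x (x + gamma *: (s - x)))%:E]].

Definition interior_strong_convexity (R : realType) (n : nat)
    (f : 'rV[R]_n -> R) (D : set 'rV[R]_n) (xs : 'rV[R]_n) : \bar R :=
  ereal_inf [set r | exists (x s : 'rV[R]_n) (gamma : R),
    [/\ D x /\ x <> xs, ray_exit D x xs s, 0 < gamma <= 1 &
        r = (scaled_gap f gamma x (x + gamma *: (s - x)))%:E]].

(* On nonempty compact [D] the supremum is attained, i.e. it is a maximum. *)
Definition duality_gap (R : realType) (n : nat) (f : 'rV[R]_n -> R)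
    (D : set 'rV[R]_n) (x : 'rV[R]_n) : R :=
  sup [set dot (grad f x) (x - s) | s in D].

Definition frank_wolfe (R : realType) (n : nat) (f : 'rV[R]_n -> R)
    (D : set 'rV[R]_n) (x s : nat -> 'rV[R]_n) (gamma : nat -> R) : Prop :=
  extreme_points D (x 0%N) /\
  forall k, [/\ argmin (extreme_points D) (dot (grad f (x k))) (s k),
                0 <= gamma k <= 1 &
                x k.+1 = x k + gamma k *: (s k - x k)].

Definition gap_step (R : realType) (n : nat) (f : 'rV[R]_n -> R)
    (D : set 'rV[R]_n) (x : nat -> 'rV[R]_n) (gamma : nat -> R) : Prop :=
  forall k, gamma k = Num.min 1 (duality_gap f D (x k) / fine (curvature f D)).

Definition line_search (R : realType) (n : nat) (f : 'rV[R]_n -> R)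
    (x s : nat -> 'rV[R]_n) (gamma : nat -> R) : Prop :=
  forall k, argmin [set t : R | 0 <= t <= 1]
                   (fun t => f (x k + t *: (s k - x k))) (gamma k).

(* [fine] loses nothing when 0 < C_f < +oo and [f] is convex: [D] then has two
   distinct points, so the infimum defining mu_f^FW is over a nonempty set of
   nonnegative reals. *)
Definition fw_rate (R : realType) (n : nat) (f : 'rV[R]_n -> R)
    (D : set 'rV[R]_n) (xs : 'rV[R]_n) : R :=
  Num.min (1 / 2)
    (fine (interior_strong_convexity f D xs) / fine (curvature f D)).

(* Main.v *)
Require Import Defs.
From HB Require Import structures.
From mathcomp Require Import all_boot all_order all_algebra.
From mathcomp Require Import all_classical all_reals all_analysis.
From mathcomp Require Import ring lra.

(** The proof plays an upper bound on the primal error [h] against a lower bound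
    on the progress of one step, both in terms of the duality gap [g] at the
    current iterate [x].

    Progress.  By definition of the curvature constant [C], moving from [x] by
    [gamma] towards the linear minimizer [s] gives
    [f (x + gamma (s - x)) <= f x - gamma g + gamma^2 C / 2]
    ([curvature_descent]).  The step [gamma = min 1 (g / C)] minimizes the right
    side over [0, 1]; an exact line search does at least as well as this step,
    so both step rules are covered by the same estimate.  That [g] is the
    decrease along [s - x], although [s] is only compared with extreme points,
    is the fact that a linear form attains its minimum over a compact set at an
    extreme point ([extreme_point_minimizes_dot]).

    Error.  Convexity gives [h <= g].  For the sharper bound [2 mu h <= g^2]
    ([interior_gap_bound]), the ray from [x] through the minimizer [z] leaves
    the domain at some [s'] beyond [z], so [z = x + gamma (s' - x)] with
    [0 < gamma <= 1], and the strong convexity constant [mu] is defined so as to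
    apply to exactly this triple:
    [h <= gamma g - gamma^2 mu / 2 <= g^2 / (2 mu)], the last inequality being
    the maximum over [gamma].

    Conclusion ([gap_step_contraction]).  If [g >= C], the full step leaves at
    most [h - g + C / 2 <= h - g / 2 <= h / 2].  If [g < C], it leaves
    [h - g^2 / (2 C) <= (1 - mu / C) h]. *)

Set Implicit Arguments.
Unset Strict Implicit.
Unset Printing Implicit Defensive.

Import Order.TTheory GRing.Theory Num.Theory.
Import numFieldNormedType.Exports.

Local Open Scope classical_set_scope.
Local Open Scope ring_scope.

(** * The Euclidean inner product *)

Section DotProduct.
Context {R : realType} {n : nat}.
Implicit Types u v w : 'rV[R]_n.

Lemma dotC u v : dot u v = dot v u.
Proof. by apply: eq_bigr => i _; rewrite mulrC. Qed.

Lemma dotDr u v w : dot u (v + w) = dot u v + dot u w.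
Proof. by rewrite -big_split; apply: eq_bigr => i _; rewrite mxE mulrDr. Qed.

Lemma dotZr a u v : dot u (a *: v) = a * dot u v.
Proof. by rewrite mulr_sumr; apply: eq_bigr => i _; rewrite mxE mulrCA. Qed.

Lemma dotNr u v : dot u (- v) = - dot u v.
Proof. by rewrite -scaleN1r dotZr mulN1r. Qed.

Lemma dotBr u v w : dot u (v - w) = dot u v - dot u w.
Proof. by rewrite dotDr dotNr. Qed.

Lemma dot0r u : dot u 0 = 0.
Proof. by rewrite -(subrr u) dotBr subrr. Qed.

Lemma dot_ge0 u : 0 <= dot u u.
Proof. by apply: sumr_ge0 => i _; rewrite -expr2 sqr_ge0. Qed.

Lemma dot_eq0 {u} : dot u u = 0 -> u = 0.
Proof.
move=> /eqP; rewrite psumr_eq0; last by move=> i _; rewrite -expr2 sqr_ge0.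
move=> /allP u0; apply/rowP => i.
have := u0 i (mem_index_enum i).
by rewrite -expr2 sqrf_eq0 mxE => /eqP.
Qed.

Lemma dot_continuous (T : topologicalType) (u v : T -> 'rV[R]_n) :
  continuous u -> continuous v -> continuous (fun y => dot (u y) (v y)).
Proof.
move=> cu cv y; rewrite /dot; apply: cvg_big => [|i _]; first exact: add_continuous.
by apply: cvgM; apply: (@continuous_comp _ _ _ _ (fun M : 'rV[R]_n => M 0 i));
  [exact: cu | exact: coord_continuous | exact: cv | exact: coord_continuous].
Qed.

(** Strict convexity of the squared Euclidean norm, in quantitative form. *)
Lemma dot_combination_self (t : R) u v :
  dot (t *: u + (1 - t) *: v) (t *: u + (1 - t) *: v) =
  t * dot u u + (1 - t) * dot v v - t * (1 - t) * dot (u - v) (u - v).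
Proof.
rewrite !dotDr !dotNr !dotZr ![dot (_ + _) _]dotC.
rewrite !dotDr !dotNr !dotZr [dot v u]dotC; ring.
Qed.

End DotProduct.

(** * Linear minimization over extreme points *)

(** The minimizers of the form are a compact face [F] of [D], and a point of [F]
    of largest Euclidean norm is extreme: by strict convexity of the squared
    norm it is not inside a segment of [F], and a segment of [D] through a point
    of a face lies in that face. *)
Lemma extreme_point_minimizes_dot {R : realType} {n : nat} (D : set 'rV[R]_n)
    (c : 'rV[R]_n) :
  compact D -> D !=set0 ->
  exists2 v, extreme_points D v & forall y, D y -> dot c v <= dot c y.
Proof.
move=> cD D0.
have cdot : continuous (dot c).
  by apply: (@dot_continuous _ _ _ (cst c) id) => y;
    [exact: cst_continuous | exact: cvg_id].
have [m mD m_min] := EVT_min_rV D0 cD (continuous_subspaceT cdot).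
rewrite inE in mD.
pose F := D `&` (dot c @^-1` [set r | r <= dot c m]).
have cF : compact F.
  by apply: compact_closedI => //; apply: preimage_closed => //.
have F0 : F !=set0 by exists m; split => /=; [exact: mD | exact: lexx].
have csq : continuous (fun y : 'rV[R]_n => dot y y).
  by apply: (@dot_continuous _ _ _ id id) => y; exact: cvg_id.
have [v vF v_max] := EVT_max_rV F0 cF (continuous_subspaceT csq).
have {vF} [Dv /= vm] : F v by rewrite inE in vF.
exists v; last first.
  by move=> y Dy; apply: le_trans vm _; apply: m_min; rewrite inE.
split => // a b t Da Db /andP[t0 t1] vE.
have ma : dot c m <= dot c a by apply: m_min; rewrite inE.
have mb : dot c m <= dot c b by apply: m_min; rewrite inE.
have cvE : dot c v = t * dot c a + (1 - t) * dot c b.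
  by rewrite vE dotDr !dotZr.
(* A weighted mean of two numbers that are at least [dot c m] equals it only if
   both do, so [a] and [b] lie in the face. *)
have am : dot c a <= dot c m by nra.
have bm : dot c b <= dot c m by nra.
have va : dot a a <= dot v v by apply: v_max; rewrite inE.
have vb : dot b b <= dot v v by apply: v_max; rewrite inE.
have ab0 : dot (a - b) (a - b) = 0.
  have := dot_combination_self t a b; rewrite -vE => vvE.
  have := dot_ge0 (a - b); set q := dot (a - b) _ in vvE *.
  move=> q0; apply/eqP; rewrite eq_le q0 andbT.
  have tt : 0 < t * (1 - t) by rewrite mulr_gt0// subr_gt0.
  rewrite -(pmulr_rle0 _ tt).
  nra.
have /eqP := dot_eq0 ab0; rewrite subr_eq0 => /eqP ab.
by move: vE; rewrite -ab -scalerDl addrC subrK scale1r.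
Qed.

Lemma argmin_extreme_points_le {R : realType} {n : nat} (D : set 'rV[R]_n)
    (c v y : 'rV[R]_n) :
  compact D -> argmin (extreme_points D) (dot c) v -> D y -> dot c v <= dot c y.
Proof.
move=> cD [_ v_min] Dy.
have [w ew w_min] := extreme_point_minimizes_dot c cD (ex_intro _ y Dy).
exact: le_trans (v_min _ ew) (w_min _ Dy).
Qed.

(** * Gradients and convexity *)

(** The total differential is linear, so directional derivatives are determined
    by the partial ones collected in [grad]. *)
Lemma dot_grad {R : realType} {n : nat} (f : 'rV[R]_n -> R) (x v : 'rV[R]_n) :
  differentiable f x -> dot (grad f x) v = 'D_v f x.
Proof.
move=> df; rewrite deriveE// {2}[v]matrix_sum_delta big_ord1 linear_sum.
by apply: eq_bigr => i _; rewrite linearZ mxE deriveE// mulrC.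
Qed.

(** Convexity of a set, rephrased for a displacement from [a] towards [b],
    which is how the algorithm writes its update. *)
Lemma convex_setP {R : realType} {n : nat} (D : set 'rV[R]_n) (a b : 'rV[R]_n)
    (t : R) : convex_set D -> D a -> D b -> 0 <= t <= 1 ->
  D (a + t *: (b - a)).
Proof.
move=> cD Da Db t01.
case/andP: t01 => t0 t1.
have tab : D (t *: b + (1 - t) *: a).
  by apply/set_mem; apply: (cD b a (Itv01 t0 t1)); rewrite inE.
by rewrite scalerBr addrCA -[X in X - _]scale1r -scalerBl.
Qed.

(** A convex function lies above its tangents: the difference quotients towards
    [y] are at most [f y - f x] for step sizes in (0, 1], hence so is their
    limit. *)
Lemma convex_gradient_le {R : realType} {n : nat} (f : 'rV[R]_n -> R)
    (x y : 'rV[R]_n) :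
  convex_function [set: 'rV[R]_n] f -> differentiable f x ->
  dot (grad f x) (y - x) <= f y - f x.
Proof.
move=> cf df; rewrite dot_grad//.
have /cvg_dnbhs_at_right dv := @diff_derivable _ _ _ f x (y - x) df.
apply: (cvgr_to_le dv); near=> t.
have t0 : 0 < t by [].
have t1 : t <= 1 by near: t; exact: nbhs_right_le.
have cft : f (t *: y + (1 - t) *: x) <= t * f y + (1 - t) * f x.
  by apply: (cf (Itv01 (ltW t0) t1)); rewrite inE.
have -> : (f \o shift x) (t *: (y - x)) = f (t *: y + (1 - t) *: x).
  by rewrite /=; congr f; rewrite scalerBr scalerBl scale1r addrAC addrA.
rewrite -[_ *: _]/(_ * _) mulrC ler_pdivrMr// mulrC.
lra.
Unshelve. all: by end_near. Qed.

(** * Leaving the domain along a ray *)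

Lemma subr_cst_continuous {R : realType} {n : nat} (x : 'rV[R]_n) :
  continuous (fun y : 'rV[R]_n => y - x).
Proof.
by move=> y; apply: (@continuousB _ _ _ id (cst x));
  [exact: cvg_id | exact: cst_continuous].
Qed.

(** The parameter of a point [y] of the ray is recovered by the continuous
    function [tau], so the ray is cut out by the closed conditions [0 <= tau y]
    and [y - x = tau y *: (z - x)]. *)
Lemma ray_closed {R : realType} {n : nat} (x z : 'rV[R]_n) :
  x <> z -> closed (ray x z).
Proof.
move=> xz; set d := z - x.
have d0 : dot d d != 0.
  by apply/eqP => /dot_eq0/eqP; rewrite subr_eq0 => /eqP zx; apply: xz.
have csub := @subr_cst_continuous _ _ x.
pose tau (y : 'rV[R]_n) := dot d (y - x) / dot d d.
have cnum : continuous (fun y : 'rV[R]_n => dot d (y - x)).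
  by apply: (@dot_continuous _ _ _ (cst d)) csub; exact: cst_continuous.
have ctau : continuous tau.
  move=> y; exact: (continuousM (cnum y) (@cst_continuous _ _ (dot d d)^-1 y)).
pose r (y : 'rV[R]_n) := y - x - tau y *: d.
have cr : continuous r.
  by move=> y; exact: (continuousB (csub y) (continuousZr_tmp (ctau y))).
have rayE : ray x z = (tau @^-1` [set t | 0 <= t]) `&`
    ((fun y => dot (r y) (r y)) @^-1` [set 0]).
  apply/seteqP; split => y /=.
    move=> [t /= t0 <-]; rewrite -/d.
    have subE : x + t *: d - x = t *: d by rewrite addrAC subrr add0r.
    have tauE : tau (x + t *: d) = t by rewrite /tau subE dotZr mulfK.
    by rewrite /r tauE subE subrr dot0r.
  move=> [tau0 /dot_eq0/eqP]; rewrite subr_eq0 => /eqP yE.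
  by exists (tau y) => //=; rewrite -yE addrC subrK.
rewrite rayE; apply: closedI; apply: preimage_closed => //.
by move=> y _; apply: (dot_continuous cr cr).
Qed.

(** The exit point is at least as far from [x] as [z], which is itself on the ray
    and in [D]; so [z] lies between [x] and the exit point, and [gamma] is the
    inverse of the ray parameter of the latter. *)
Lemma ray_exit_exists {R : realType} {n : nat} (D : set 'rV[R]_n)
    (x z : 'rV[R]_n) :
  compact D -> D z -> x <> z ->
  exists s gamma, [/\ ray_exit D x z s, 0 < gamma <= 1 &
                      x + gamma *: (s - x) = z].
Proof.
move=> cD Dz xz.
have zray : ray x z z by exists 1 => //=; rewrite scale1r addrC subrK.
have cK : compact (ray x z `&` D).
  by rewrite setIC; apply: compact_closedI => //; exact: ray_closed.
have cnorm : continuous (fun y : 'rV[R]_n => enorm (y - x)).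
  have csub := @subr_cst_continuous _ _ x.
  move=> y.
  apply: (@continuous_comp _ _ _ (fun y : 'rV[R]_n => dot (y - x) (y - x)));
    last exact: sqrt_continuous.
  exact: dot_continuous.
have [s sK s_max] := EVT_max_rV (ex_intro _ z (conj zray Dz)) cK
  (continuous_subspaceT cnorm).
rewrite inE in sK; have [[t /= t0 sE] Ds] := sK.
have zs : enorm (z - x) <= enorm (s - x) by apply: s_max; rewrite inE.
have dd : 0 < dot (z - x) (z - x).
  rewrite lt0r dot_ge0 andbT; apply/eqP => /dot_eq0/eqP.
  by rewrite subr_eq0 => /eqP zx; apply: xz.
have sxE : s - x = t *: (z - x) by rewrite -sE addrAC subrr add0r.
have t1 : 1 <= t.
  move: zs; rewrite /enorm sxE ler_sqrt ?dot_ge0// dotZr.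
  rewrite [dot (t *: _) _]dotC dotZr mulrA ler_pMl// => tt1.
  nra.
exists s, t^-1; split.
- by split => // b Kb; apply: s_max; rewrite inE.
- by rewrite invr_gt0 invf_le1 ?t1 (lt_le_trans ltr01 t1).
- rewrite sxE scalerA mulVf ?gt_eqF ?(lt_le_trans ltr01 t1)//.
  by rewrite scale1r addrC subrK.
Qed.

(** * Curvature and strong convexity bounds *)

(** [scaled_gap] is the coefficient of the quadratic remainder in the
    first-order expansion of [f] at [x]; bounds on it, such as the two constants
    of the problem, turn into quadratic models of [f]. *)
Lemma scaled_gapE {R : realType} {n : nat} (f : 'rV[R]_n -> R) (x s : 'rV[R]_n)
    (gamma : R) : gamma != 0 ->
  f (x + gamma *: (s - x)) = f x + gamma * dot (grad f x) (s - x) +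
    gamma ^+ 2 / 2 * scaled_gap f gamma x (x + gamma *: (s - x)).
Proof.
move=> g0; rewrite /scaled_gap [_ + _ *: _ - x]addrAC subrr add0r dotZr.
by field.
Qed.

Lemma curvature_descent {R : realType} {n : nat} (f : 'rV[R]_n -> R)
    (D : set 'rV[R]_n) (x s : 'rV[R]_n) (gamma : R) :
  (0 < curvature f D)%E -> (curvature f D < +oo)%E -> D x -> D s ->
  0 <= gamma <= 1 ->
  f (x + gamma *: (s - x)) <= f x + gamma * dot (grad f x) (s - x) +
    gamma ^+ 2 / 2 * fine (curvature f D).
Proof.
move=> C0 Coo Dx Ds /andP[g0 g1].
have [->|gN0] := eqVneq gamma 0.
  by rewrite scale0r addr0 mul0r expr0n/= !mul0r !addr0.
rewrite scaled_gapE// lerD2l ler_wpM2l ?divr_ge0 ?sqr_ge0//.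
rewrite -lee_fin fineK ?fin_numElt ?Coo ?(lt_trans _ C0)//.
by apply: ereal_sup_ubound; exists x, s, gamma; split => //; rewrite lt0r gN0 g0.
Qed.

(** Any bound [g] on the decrease of the linearization over [D] controls the
    error at [x] quadratically.  With [gamma] the position of [z] between [x]
    and the exit point, the strong convexity lower model at [z] reads
    [f x - f z <= gamma g - gamma^2 mu / 2]. *)
Lemma interior_gap_bound {R : realType} {n : nat} (f : 'rV[R]_n -> R)
    (D : set 'rV[R]_n) (x z : 'rV[R]_n) (g : R) :
  compact D -> D x -> D z -> f z <= f x ->
  (forall y, D y -> dot (grad f x) (x - y) <= g) ->
  2 * fine (interior_strong_convexity f D z) * (f x - f z) <= g ^+ 2.
Proof.
move=> cD Dx Dz fzx gap.
have [->|/eqP xz] := eqVneq x z; first by rewrite subrr mulr0 sqr_ge0.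
set mu := fine _.
(* This case also covers an infinite constant, which [fine] sends to 0. *)
have [mu0|mu0] := leP mu 0.
  apply: le_trans (sqr_ge0 g).
  by rewrite mulr_le0_ge0 ?subr_ge0// pmulr_rle0.
have [s [gamma [sexit g01 zE]]] := ray_exit_exists cD Dz xz.
have Ds : D s by case: sexit => -[].
have /andP[g0 g1] := g01.
have muE : mu%:E = interior_strong_convexity f D z.
  by move: mu0; rewrite /mu; case: interior_strong_convexity => //=; rewrite ltxx.
have muq : mu <= scaled_gap f gamma x (x + gamma *: (s - x)).
  by rewrite -lee_fin muE; apply: ereal_inf_lbound; exists x, s, gamma.
have fE := scaled_gapE f x s (lt0r_neq0 g0).
rewrite zE in fE muq.
have gs : dot (grad f x) (x - s) <= g by exact: gap.
rewrite -opprB dotNr in gs.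
have hle : f x - f z <= gamma * g - gamma ^+ 2 / 2 * mu.
  have : gamma ^+ 2 / 2 * mu <= gamma ^+ 2 / 2 * scaled_gap f gamma x z.
    by rewrite ler_wpM2l// divr_ge0 ?sqr_ge0.
  have : gamma * - dot (grad f x) (s - x) <= gamma * g by rewrite ler_wpM2l// ltW.
  rewrite fE; lra.
have : 2 * mu * (f x - f z) <= 2 * mu * (gamma * g - gamma ^+ 2 / 2 * mu).
  by rewrite ler_wpM2l// mulr_ge0// ltW.
(* Maximizing over [gamma]: the quadratic bound falls short of [g ^+ 2] by the
   square of [g - gamma * mu]. *)
have := sqr_ge0 (g - gamma * mu); nra.
Qed.

(** * One step of the algorithm *)

Lemma duality_gapE {R : realType} {n : nat} (f : 'rV[R]_n -> R)
    (D : set 'rV[R]_n) (x s : 'rV[R]_n) :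
  D s -> (forall y, D y -> dot (grad f x) s <= dot (grad f x) y) ->
  duality_gap f D x = dot (grad f x) (x - s).
Proof.
move=> Ds s_min.
have ub : ubound [set dot (grad f x) (x - y) | y in D] (dot (grad f x) (x - s)).
  by move=> _ [y Dy <-]; rewrite !dotBr lerD2l lerN2 s_min.
apply/eqP; rewrite eq_le; apply/andP; split.
- by apply: ge_sup => //; exists (dot (grad f x) (x - s)), s.
- by apply: ub_le_sup; [exists (dot (grad f x) (x - s)) | exists s].
Qed.

Lemma frank_wolfe_in {R : realType} {n : nat} (f : 'rV[R]_n -> R)
    (D : set 'rV[R]_n) (x s : nat -> 'rV[R]_n) (gamma : nat -> R) (k : nat) :
  convex_set D -> frank_wolfe f D x s gamma -> D (x k).
Proof.
move=> cD [[Dx0 _] run]; elim: k => // k IH.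
have [[[Ds _] _] g01 ->] := run k.
exact: convex_setP.
Qed.

(** The arithmetic of the rate.  The factor 1/2 comes from the full step, which
    is only taken when [g >= C]; otherwise the decrease is [g^2 / (2 C)], at
    least [mu / C * h] by the quadratic error bound. *)
Lemma gap_step_contraction {R : realType} (C mu g h : R) :
  0 < C -> 0 <= h -> h <= g -> 2 * mu * h <= g ^+ 2 ->
  let gamma := Num.min 1 (g / C) in
  h - gamma * g + gamma ^+ 2 / 2 * C <= (1 - Num.min (1 / 2) (mu / C)) * h.
Proof.
move=> C0 h0 hg mug /=.
have rho12 : Num.min (1 / 2) (mu / C) <= 1 / 2 by rewrite ge_min lexx.
have rhomu : Num.min (1 / 2) (mu / C) <= mu / C by rewrite ge_min lexx orbT.
move: (Num.min (1 / 2) _) rho12 rhomu => rho rho12 rhomu.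
have [gC|Cg] := leP 1 (g / C).
  move: gC; rewrite ler_pdivlMr// => gC.
  nra.
have rhoC : rho * C <= mu by rewrite -ler_pdivlMr.
have -> : h - g / C * g + (g / C) ^+ 2 / 2 * C = h - g ^+ 2 / 2 / C.
  by field; rewrite gt_eqF.
rewrite mulrBl mul1r lerD2l lerN2 ler_pdivlMr//.
nra.
Qed.

Theorem theorem3 (R : realType) (n : nat) (D : set 'rV[R]_n)
    (f : 'rV[R]_n -> R) (xs : 'rV[R]_n)
    (x s : nat -> 'rV[R]_n) (gamma : nat -> R)
    (D_compact : compact D) (D_convex : convex_set D)
    (f_convex : convex_function [set: 'rV[R]_n] f)
    (f_diff : forall y : 'rV[R]_n, differentiable f y)
    (xs_min : argmin D f xs) (xs_relint : relative_interior D xs)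
    (Cf_gt0 : (0 < curvature f D)%E) (Cf_fin : (curvature f D < +oo)%E)
    (run : frank_wolfe f D x s gamma)
    (step : gap_step f D x gamma \/ line_search f x s gamma) (k : nat) :
  f (x k.+1) - f xs <= (1 - fw_rate f D xs) * (f (x k) - f xs).
Proof.
have Dx : D (x k) by exact: frank_wolfe_in run.
have [Dxs fxs_min] := xs_min.
have [sk_min _ xS] := proj2 run k.
have Ds : D (s k) by case: sk_min => -[].
have s_le y : D y -> dot (grad f (x k)) (s k) <= dot (grad f (x k)) y.
  exact: argmin_extreme_points_le.
set g := dot (grad f (x k)) (x k - s k).
have gE : duality_gap f D (x k) = g by exact: duality_gapE.
have gap y : D y -> dot (grad f (x k)) (x k - y) <= g.
  by move=> Dy; rewrite /g !dotBr lerD2l lerN2 s_le.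
set h := f (x k) - f xs.
have h0 : 0 <= h by rewrite subr_ge0 fxs_min.
have hg : h <= g.
  apply: le_trans (gap _ Dxs).
  have := convex_gradient_le xs f_convex (f_diff (x k)).
  rewrite -[x k - xs]opprB dotNr /h; lra.
have C0 : 0 < fine (curvature f D) by rewrite fine_gt0// Cf_gt0.
pose t := Num.min 1 (g / fine (curvature f D)).
have t01 : 0 <= t <= 1.
  by rewrite /t ge_min lexx andbT le_min ler01 divr_ge0 ?(ltW C0) ?(le_trans h0 hg).
(* Only the line search can differ from the step [t], and it can only do
   better. *)
have next_le : f (x k.+1) <= f (x k + t *: (s k - x k)).
  rewrite xS; case: step => [gstep|ls].
    by rewrite gstep gE.
  by have [_] := ls k; apply.
have descent := curvature_descent Cf_gt0 Cf_fin Dx Ds t01.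
have := gap_step_contraction C0 h0 hg
  (interior_gap_bound D_compact Dx Dxs (fxs_min _ Dx) gap).
rewrite /= -/t -/(fw_rate f D xs).
apply: le_trans; rewrite /h.
have -> : g = - dot (grad f (x k)) (s k - x k) by rewrite /g -opprB dotNr.
move: next_le descent; lra.
Qed.
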